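(* Let $A\in\mathbb{C}^{m\times n}$, $W\in\mathbb{C}^{n\times m}$ with $\mathrm{ind}(WA)=k$, and let $G=A(WA)^k[(WA)^k]^{\dagger}$. The $W$-weighted core-EP inverse of $A$ is a $\{2\}$-inverse of $WAW$ with range $\mathcal{R}(G)$ and null space $\mathcal{N}(G)$, i.e., $$A^{\mathrm{cEP},W}=(WAW)^{(2)}_{\mathcal{R}(G),\mathcal{N}(G)}.$$
   Context: For a square complex matrix $B$, $\mathrm{ind}(B)$ is the smallest non-negative integer $j$ with $\mathrm{rank}(B^j)=\mathrm{rank}(B^{j+1})$ (with $B^0=I$). $B^{\dagger}$, $\mathcal{R}(B)$ and $\mathcal{N}(B)$ denote the Moore-Penrose inverse, range (column space) and null space of $B$. For $A\in\mathbb{C}^{m\times n}$, $W\in\mathbb{C}^{n\times m}$ and $p=\max\{\mathrm{ind}(AW),\mathrm{ind}(WA)\}$, the $W$-weighted core-EP inverse $A^{\mathrm{cEP},W}$ is the unique $Y\in\mathbb{C}^{m\times n}$ with $WAWY=(WA)^p[(WA)^p]^{\dagger}$ and $\mathcal{R}(Y)\subseteq\mathcal{R}((AW)^p)$. A $\{2\}$-inverse (outer inverse) of a matrix $M$ is a matrix $X$ with $XMX=X$. If $M$ has a $\{2\}$-inverse $X$ with $\mathcal{R}(X)=T$ and $\mathcal{N}(X)=S$, then $X$ is unique and is denoted $M^{(2)}_{T,S}$. *)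

(* Defs.v *)
From mathcomp Require Import all_boot all_order all_algebra.
From mathcomp Require Import spectral sesquilinear.
From mathcomp Require Import boolp classical_sets reals.

Set Implicit Arguments.
Unset Strict Implicit.
Unset Printing Implicit Defensive.

Import Order.TTheory GRing.Theory Num.Theory.
Local Open Scope ring_scope.
Local Open Scope sesquilinear_scope.

Section Defs.
Variable C : numClosedFieldType.

Definition mxrange m n (B : 'M[C]_(m, n)) : {vspace 'cV[C]_m} :=
  limg (linfun (mulmx B : 'cV[C]_n -> 'cV[C]_m)).

Definition mxnull m n (B : 'M[C]_(m, n)) : {vspace 'cV[C]_n} :=
  lker (linfun (mulmx B : 'cV[C]_n -> 'cV[C]_m)).

Lemma mxrangeP m n (B : 'M[C]_(m, n)) (y : 'cV[C]_m) :
  reflect (exists x : 'cV[C]_n, y = B *m x) (y \in mxrange B).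
Proof.
apply: (iffP memv_imgP) => [[x _ ->]|[x ->]]; first by exists x; rewrite lfunE.
by exists x; rewrite ?memvf ?lfunE.
Qed.

Lemma mxnullP m n (B : 'M[C]_(m, n)) (x : 'cV[C]_n) :
  reflect (B *m x = 0) (x \in mxnull B).
Proof. by rewrite memv_ker lfunE; apply: eqP. Qed.

Lemma mxrange_subP m n p (B : 'M[C]_(m, n)) (D : 'M[C]_(m, p)) :
  reflect (exists V, B = D *m V) (mxrange B <= mxrange D)%VS.
Proof.
apply: (iffP subvP) => [sBD|[V ->] y /mxrangeP[x ->]]; last first.
  by apply/mxrangeP; exists (V *m x); rewrite mulmxA.
have colB j : exists v, col j B = D *m v.
  by apply/mxrangeP/sBD/mxrangeP; exists (delta_mx j 0); exact: colE.
have [f fP] := boolp.choice colB.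
exists (\matrix_(i, j) f j i 0); apply/matrixP => i j.
have /matrixP/(_ i 0) := fP j; rewrite !mxE => ->.
by apply: eq_bigr => k _; rewrite mxE.
Qed.

Lemma mxind_subproof n (B : 'M[C]_n) :
  exists j, \rank (B ^+ j) == \rank (B ^+ j.+1).
Proof.
apply/not_existsP => H.
have lt j : (\rank (B ^+ j.+1) < \rank (B ^+ j))%N.
  rewrite ltn_neqAle exprS -mulmxE mxrankM_maxr andbT.
  by apply/negP => /eqP e; apply: (H j); rewrite exprS -mulmxE e.
have le j : (\rank (B ^+ j) + j <= n)%N.
  elim: j => [|j IH]; first by rewrite addn0 rank_leq_row.
  by rewrite addnS; apply: leq_trans IH; rewrite ltn_add2r.
by have := le n.+1; rewrite addnS ltnNge leq_addl.
Qed.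

Definition mxind n (B : 'M[C]_n) : nat := ex_minn (mxind_subproof B).

Lemma mxind_rank n (B : 'M[C]_n) :
  \rank (B ^+ mxind B) = \rank (B ^+ (mxind B).+1).
Proof. by rewrite /mxind; case: ex_minnP => j /eqP. Qed.

Lemma mxind_min n (B : 'M[C]_n) j :
  \rank (B ^+ j) = \rank (B ^+ j.+1) -> (mxind B <= j)%N.
Proof. by move=> e; rewrite /mxind; case: ex_minnP => i _; apply; apply/eqP. Qed.

Lemma mxind_powr n (B : 'M[C]_n) p q : (mxind B <= p)%N ->
  exists Z, B ^+ p = B ^+ (p + q) *m Z.
Proof.
move=> lep; have [Z eZ] : exists Z, B ^+ p = B ^+ p.+1 *m Z.
  have /submxP[Z eZ] : ((B ^+ mxind B)^T <= (B ^+ (mxind B).+1)^T)%MS.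
    rewrite -(geq_leqif (mxrank_leqif_sup _)) ?mxrank_tr ?mxind_rank //.
    by rewrite exprSr -mulmxE trmx_mul submxMl.
  exists Z^T; rewrite -(subnK lep) -addnS !exprD -!mulmxE -mulmxA; congr (_ *m _).
  by apply: trmx_inj; rewrite trmx_mul trmxK eZ.
elim: q => [|q [V eV]]; first by exists 1%:M; rewrite addn0 mulmx1.
exists (Z *m V); rewrite mulmxA {1}eV; congr (_ *m _).
by rewrite addnS -addSn (addnC p.+1) (addnC p) !exprD -!mulmxE -mulmxA -eZ.
Qed.

Lemma mxind_powl n (B : 'M[C]_n) p q : (mxind B <= p)%N ->
  exists Z, B ^+ p = Z *m B ^+ (p + q).
Proof.
move=> lep; have [Z eZ] : exists Z, B ^+ p = Z *m B ^+ p.+1.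
  have /submxP[Z eZ] : (B ^+ mxind B <= B ^+ (mxind B).+1)%MS.
    rewrite -(geq_leqif (mxrank_leqif_sup _)) ?mxind_rank //.
    by rewrite exprS -mulmxE submxMl.
  exists Z; rewrite -(subnKC lep) -addSn !exprD -!mulmxE mulmxA; congr (_ *m _).
  exact: eZ.
elim: q => [|q [V eV]]; first by exists 1%:M; rewrite addn0 mul1mx.
exists (V *m Z); rewrite -mulmxA {1}eV; congr (_ *m _).
by rewrite addnS -addSn !exprD -!mulmxE mulmxA -eZ.
Qed.

(* The four Penrose equations. *)
Definition is_mpinv m n (B : 'M[C]_(m, n)) (X : 'M[C]_(n, m)) : Prop :=
  [/\ B *m X *m B = B,
      X *m B *m X = X,
      (B *m X) ^t* = B *m X
    & (X *m B) ^t* = X *m B].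

Definition mpinv m n (B : 'M[C]_(m, n)) : 'M[C]_(n, m) := xget 0 (is_mpinv B).

Lemma adjmxM m n p (A : 'M[C]_(m, n)) (B : 'M[C]_(n, p)) :
  (A *m B) ^t* = B ^t* *m A ^t*.
Proof. by rewrite trmx_mul map_mxM. Qed.

Lemma is_mpinv_unique m n (B : 'M[C]_(m, n)) X Y :
  is_mpinv B X -> is_mpinv B Y -> X = Y.
Proof.
move=> [x1 x2 x3 x4] [y1 y2 y3 y4].
have eBX : B *m X = B *m Y.
  by rewrite -{1}y1 -(mulmxA (B *m Y)) -y3 -{1}x3 -adjmxM mulmxA x1 y3.
have eXB : X *m B = Y *m B.
  by rewrite -{1}y1 -!mulmxA mulmxA -x4 -{1}y4 -adjmxM -!mulmxA (mulmxA B) x1 y4.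
by rewrite -x2 -mulmxA eBX mulmxA eXB y2.
Qed.

Lemma unit_gram n p (G : 'M[C]_(n, p)) : row_free G -> G *m G ^t* \in unitmx.
Proof.
move=> fG; rewrite -row_free_unit -kermx_eq0; apply/rowV0P => u /sub_kermxP uG.
apply/eqP; rewrite -(mulmx_free_eq0 _ fG) -(dnorm_eq0 (@dotmx C p)).
by rewrite -[X in X == 0]/(dotmx (u *m G) (u *m G)) dotmxE adjmxM mulmxA -(mulmxA u) uG mul0mx mxE.
Qed.

Lemma is_mpinv_exists m n (B : 'M[C]_(m, n)) : exists X, is_mpinv B X.
Proof.
pose F := col_base B; pose G := row_base B.
have uG : G *m G ^t* \in unitmx by apply: unit_gram; apply: row_base_free.
have uF : F ^t* *m F \in unitmx.
  rewrite -[X in _ *m X]trmxCK; apply: unit_gram.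
  by rewrite /row_free mxrank_map mxrank_tr; have := col_base_full B.
have eB : B = F *m G by rewrite mulmx_base.
clearbody F G; move: (\rank B) F G uG uF eB => r F G uG uF eB.
pose I := invmx (G *m G ^t*); pose J := invmx (F ^t* *m F).
have hI : I ^t* = I by rewrite /I trmx_inv map_invmx adjmxM trmxCK.
have hJ : J ^t* = J by rewrite /J trmx_inv map_invmx adjmxM trmxCK.
pose X := G ^t* *m I *m (J *m F ^t*).
have BX : B *m X = F *m J *m F ^t*.
  by rewrite eB /X -!mulmxA (mulmxA G) (mulKVmx uG).
have XB : X *m B = G ^t* *m I *m G.
  by rewrite eB /X -!mulmxA (mulmxA _ F G) (mulKmx uF).
exists X; split.
- by rewrite BX eB -!mulmxA (mulmxA _ F G) (mulKmx uF).
- by rewrite XB /X -!mulmxA (mulmxA G) (mulKVmx uG).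
- by rewrite BX !adjmxM hJ trmxCK mulmxA.
- by rewrite XB !adjmxM hI trmxCK mulmxA.
Qed.

Lemma mpinvP m n (B : 'M[C]_(m, n)) : is_mpinv B (mpinv B).
Proof. by apply: xgetPex; exact: is_mpinv_exists. Qed.

Definition is_wcEP m n (A : 'M[C]_(m, n)) (W : 'M[C]_(n, m))
    (Y : 'M[C]_(m, n)) : Prop :=
  let p := maxn (mxind (A *m W)) (mxind (W *m A)) in
  W *m A *m W *m Y = (W *m A) ^+ p *m mpinv ((W *m A) ^+ p) /\
  (mxrange Y <= mxrange ((A *m W) ^+ p))%VS.

Definition wcEP m n (A : 'M[C]_(m, n)) (W : 'M[C]_(n, m)) : 'M[C]_(m, n) :=
  xget 0 (is_wcEP A W).

Lemma mulmx_powC m n (A : 'M[C]_(m, n)) (W : 'M[C]_(n, m)) p :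
  (A *m W) ^+ p *m A = A *m (W *m A) ^+ p.
Proof.
elim: p => [|p IH]; first by rewrite !expr0 mul1mx mulmx1.
by rewrite !exprS -!mulmxE -mulmxA IH !mulmxA.
Qed.

Lemma is_wcEP_exists m n (A : 'M[C]_(m, n)) (W : 'M[C]_(n, m)) :
  exists Y, is_wcEP A W Y.
Proof.
rewrite /is_wcEP; set p := maxn _ _; set B := W *m A.
have [Z eZ] := mxind_powr 2 (leq_maxr _ _ : (mxind B <= p)%N).
pose V := Z *m mpinv (B ^+ p).
exists ((A *m W) ^+ p *m (A *m V)); split; last first.
  by apply/mxrange_subP; exists (A *m V).
rewrite (mulmxA _ A) mulmx_powC -/B.
suff -> : W *m A *m W *m (A *m B ^+ p *m V) = B ^+ (p + 2) *m V.
  by rewrite /V mulmxA -eZ.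
by rewrite addnC exprD expr2 -!mulmxE /B !mulmxA.
Qed.

Lemma is_wcEP_unique m n (A : 'M[C]_(m, n)) (W : 'M[C]_(n, m)) Y1 Y2 :
  is_wcEP A W Y1 -> is_wcEP A W Y2 -> Y1 = Y2.
Proof.
rewrite /is_wcEP; set p := maxn _ _.
move=> [e1 /mxrange_subP[V1 r1]] [e2 /mxrange_subP[V2 r2]].
have [Z eZ] := mxind_powl 2 (leq_maxl _ _ : (mxind (A *m W) <= p)%N).
have YE Y V : Y = (A *m W) ^+ p *m V -> Y = Z *m (A *m (W *m A *m W *m Y)).
  move=> rY; rewrite {1}rY {1}eZ addnC exprD expr2 -!mulmxE -!mulmxA; congr (_ *m _).
  by rewrite rY.
by rewrite (YE _ _ _ r1) (YE _ _ _ r2) e1 e2.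
Qed.

Lemma wcEPP m n (A : 'M[C]_(m, n)) (W : 'M[C]_(n, m)) : is_wcEP A W (wcEP A W).
Proof. by apply: xgetPex; exact: is_wcEP_exists. Qed.

Definition outer_inverse m n (M : 'M[C]_(m, n)) (X : 'M[C]_(n, m)) : Prop :=
  X *m M *m X = X.

Definition is_outer_inv_TS m n (M : 'M[C]_(m, n)) (T : {vspace 'cV[C]_n})
    (S : {vspace 'cV[C]_m}) (X : 'M[C]_(n, m)) : Prop :=
  [/\ outer_inverse M X, mxrange X = T & mxnull X = S].

(* M^(2)_(T,S): unlike mpinv and wcEP, the matrix need not exist for given
   T and S; the value is then the junk 0. *)
Definition outer_inv_TS m n (M : 'M[C]_(m, n)) (T : {vspace 'cV[C]_n})
    (S : {vspace 'cV[C]_m}) : 'M[C]_(n, m) :=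
  xget 0 (is_outer_inv_TS M T S).

Lemma is_outer_inv_TS_unique m n (M : 'M[C]_(m, n)) T S X Y :
  is_outer_inv_TS M T S X -> is_outer_inv_TS M T S Y -> X = Y.
Proof.
move=> [oX rX nX] [oY rY nY].
have /mxrange_subP[V eX] : (mxrange X <= mxrange Y)%VS by rewrite rX rY.
have YMX : Y *m M *m X = X by rewrite eX mulmxA oY.
rewrite -YMX; apply/esym/eqP; rewrite -subr_eq0 -mulmxA -{1}(mulmx1 Y) -mulmxBr.
apply/eqP/matrixP => i j.
have /mxnullP : col j (1%:M - M *m X) \in mxnull Y.
  rewrite nY -nX; apply/mxnullP; rewrite colE mulmxA mulmxBr mulmx1 mulmxA oX.
  by rewrite subrr mul0mx.
by rewrite colE mulmxA -colE => /colP/(_ i); rewrite !mxE.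
Qed.

End Defs.

(* Main.v *)
Require Import Defs.
From mathcomp Require Import all_boot all_order all_algebra.
From mathcomp Require Import sesquilinear classical_sets.
From mathcomp Require Import reals complex.
Import Order.TTheory GRing.Theory Num.Theory.
Local Open Scope ring_scope.
Local Open Scope complex_scope.

(** Put [B = W A], let [P] be the orthogonal projector onto the core range
    [R(B ^ k)] of [B], and let [Y] be the weighted core-EP inverse, so that
    [G = A P].  The defining equation [W A W Y = B ^ p (B ^ p)^+] involves an
    exponent [p >= k], but an orthogonal projector is determined by its range,
    and the ranges of the powers of [B] are stationary from [k] on; hence
    [W A W Y = P].

    The square [(A W) ^ 2] maps the core
    range [R((A W) ^ p)] bijectively onto itself; let [Z] be a matrix that
    inverts it there.  Since [(A W) ^ 2 Y = A P = G] and [Y] has its columns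
    in the core range, [Y = Z G].  So [Y] and [G] are left multiples of each
    other, which equates the null spaces, and [Y (W A W) Y = Z A P P = Y].
    For the ranges ([wcEP_range]), the identity [A B ^ p = (A W) ^ p A] places
    [R(Y)] inside [R(G)] and [R(G)] inside the core range; there [Y (W A W)]
    acts as [Z (A W) ^ 2], the identity, so [R(G)] is inside [R(Y)]. *)

Section WeightedCoreEP.
Variable C : numClosedFieldType.
Local Open Scope sesquilinear_scope.

Lemma mpinv_proj_id m n p (B : 'M[C]_(m, n)) (D : 'M[C]_(m, p)) :
  (mxrange D <= mxrange B)%VS -> B *m mpinv B *m D = D.
Proof.
by case: (mpinvP B) => e _ _ _ /mxrange_subP[V ->]; rewrite mulmxA e.
Qed.

(** The two orthogonal projectors fix each other's columns, so that
    [P Q = Q] and [Q P = P]; taking adjoints in the first equation gives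
    [Q P = Q]. *)
Lemma mpinv_proj_range m n p (B : 'M[C]_(m, n)) (D : 'M[C]_(m, p)) :
  mxrange B = mxrange D -> B *m mpinv B = D *m mpinv D.
Proof.
move=> eBD.
have PQ : B *m mpinv B *m (D *m mpinv D) = D *m mpinv D.
  by rewrite mulmxA mpinv_proj_id ?eBD.
have QP : D *m mpinv D *m (B *m mpinv B) = B *m mpinv B.
  by rewrite mulmxA mpinv_proj_id ?eBD.
have [_ _ hP _] := mpinvP B; have [_ _ hQ _] := mpinvP D.
by rewrite -QP -{1}hQ -hP -adjmxM PQ.
Qed.

Lemma mpinv_proj_idem m n (B : 'M[C]_(m, n)) :
  B *m mpinv B *m (B *m mpinv B) = B *m mpinv B.
Proof. by case: (mpinvP B) => e _ _ _; rewrite mulmxA e. Qed.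

Lemma mxrange_pow_stable n (B : 'M[C]_n) p : (mxind B <= p)%N ->
  mxrange (B ^+ p) = mxrange (B ^+ mxind B).
Proof.
move=> lep; apply/eqP; rewrite eqEsubv; apply/andP; split; apply/mxrange_subP.
  by exists (B ^+ (p - mxind B)); rewrite mulmxE -exprD subnKC.
have [V eV] := mxind_powr (p - mxind B) (leqnn (mxind B)).
by exists V; rewrite {1}eV subnKC.
Qed.

Lemma mxnull_lmul m1 m2 n (X : 'M[C]_(m1, n)) (Y : 'M[C]_(m2, n)) U V :
  X = U *m Y -> Y = V *m X -> mxnull X = mxnull Y.
Proof.
move=> eX eY; apply/vspaceP => x; apply/mxnullP/mxnullP => h.
  by rewrite eY -mulmxA h mulmx0.
by rewrite eX -mulmxA h mulmx0.
Qed.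

Section Weighted.
Variables (m n : nat) (A : 'M[C]_(m, n)) (W : 'M[C]_(n, m)).

Let k := mxind (W *m A).
Let p := maxn (mxind (A *m W)) k.
Let P := (W *m A) ^+ k *m mpinv ((W *m A) ^+ k).
Let Y := wcEP A W.

Lemma core_proj_pow : (W *m A) ^+ p *m mpinv ((W *m A) ^+ p) = P.
Proof. by apply/mpinv_proj_range/mxrange_pow_stable/leq_maxr. Qed.

Lemma wcEP_eq : W *m A *m W *m Y = P.
Proof. by rewrite (wcEPP A W).1 core_proj_pow. Qed.

Lemma wcEP_sq : A *m W *m (A *m W) *m Y = A *m P.
Proof. by rewrite -wcEP_eq !mulmxA. Qed.

(** [Z] inverts [(A W) ^ 2] on the core range of [A W]; it sends [A P], the
    image of [Y] under this square, back to [Y]. *)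
Lemma wcEP_lmul : exists2 Z, Y = Z *m (A *m P) &
  Z *m (A *m W *m (A *m W)) *m (A *m W) ^+ p = (A *m W) ^+ p.
Proof.
have [Z eZ] := mxind_powl 2 (leq_maxl _ _ : (mxind (A *m W) <= p)%N).
have ZK : Z *m (A *m W *m (A *m W)) *m (A *m W) ^+ p = (A *m W) ^+ p.
  by rewrite [RHS]eZ addnC exprD expr2 -!mulmxE !mulmxA.
exists Z => //; have [_ /mxrange_subP[V eY]] := wcEPP A W.
by rewrite -wcEP_sq mulmxA /Y eY -/k -/p mulmxA ZK.
Qed.

Lemma wcEP_outer : outer_inverse (W *m A *m W) Y.
Proof.
have [Z eY _] := wcEP_lmul.
by rewrite /outer_inverse -mulmxA wcEP_eq eY -(mulmxA Z) -(mulmxA A) mpinv_proj_idem.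
Qed.

Lemma wcEP_null : mxnull Y = mxnull (A *m P).
Proof.
have [Z eY _] := wcEP_lmul.
exact: mxnull_lmul eY (esym wcEP_sq).
Qed.

(** For [R(Y) <= R(A P)]: the core range is also [R((A W) ^ (p + 1))], and
    [(A W) ^ (p + 1) = A (W A) ^ p W] where [P] fixes the columns of
    [(W A) ^ p].  For the converse, [Y (W A W)] is the identity on [R(A P)],
    because it acts on the core range as [Z (A W) ^ 2]. *)
Lemma wcEP_range : mxrange Y = mxrange (A *m P).
Proof.
have PB : P *m (W *m A) ^+ p = (W *m A) ^+ p.
  by apply: mpinv_proj_id; rewrite mxrange_pow_stable ?leq_maxr.
apply/eqP; rewrite eqEsubv; apply/andP; split; apply/mxrange_subP.
  have [_ /mxrange_subP[V eY]] := wcEPP A W.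
  have [Z eZ] := mxind_powr 1 (leq_maxl _ _ : (mxind (A *m W) <= p)%N).
  exists ((W *m A) ^+ p *m W *m Z *m V).
  rewrite /Y eY -/k -/p eZ addn1 exprSr -mulmxE -(mulmxA A P) !(mulmxA P) PB.
  by rewrite !mulmxA mulmx_powC.
have [Z eY ZK] := wcEP_lmul; exists (W *m A *m W *m (A *m P)).
(* [(W A) ^ 2] preserves the range of [(W A) ^ p], which [P] fixes pointwise. *)
have eBBP : W *m A *m (W *m A) *m P
          = (W *m A) ^+ p *m (W *m A *m (W *m A) *m mpinv ((W *m A) ^+ p)).
  rewrite -core_proj_pow !(mulmxA _ _ (mpinv _)); congr (_ *m _).
  by rewrite !mulmxE -expr2 -!exprD addnC.
have PBB : P *m (W *m A *m (W *m A) *m P) = W *m A *m (W *m A) *m P.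
  by rewrite eBBP mulmxA PB.
have eAP : A *m P = (A *m W) ^+ p *m (A *m mpinv ((W *m A) ^+ p)).
  by rewrite -core_proj_pow mulmxA -mulmx_powC mulmxA.
have -> : W *m A *m W *m (A *m P) = W *m A *m (W *m A) *m P.
  by rewrite !mulmxA.
rewrite {1}eY -(mulmxA Z) -(mulmxA A) PBB.
have -> : A *m (W *m A *m (W *m A) *m P) = A *m W *m (A *m W) *m (A *m P).
  by rewrite !mulmxA.
by rewrite mulmxA eAP (mulmxA (Z *m _)) ZK.
Qed.

Lemma wcEP_outer_inv_TS :
  is_outer_inv_TS (W *m A *m W) (mxrange (A *m P)) (mxnull (A *m P)) Y.
Proof. by split; [exact: wcEP_outer|exact: wcEP_range|exact: wcEP_null]. Qed.

End Weighted.

Lemma outer_inv_TS_eq m n (M : 'M[C]_(m, n)) T S X :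
  is_outer_inv_TS M T S X -> X = outer_inv_TS M T S.
Proof.
move=> hX; apply: (is_outer_inv_TS_unique hX).
by apply: xgetPex; exists X.
Qed.

End WeightedCoreEP.

Theorem theorem2p6 (R : realType) (m n k : nat)
    (A : 'M[R[i]]_(m, n)) (W : 'M[R[i]]_(n, m)) (hk : mxind (W *m A) = k) :
  let G := A *m (W *m A) ^+ k *m mpinv ((W *m A) ^+ k) in
  is_outer_inv_TS (W *m A *m W) (mxrange G) (mxnull G) (wcEP A W) /\
  wcEP A W = outer_inv_TS (W *m A *m W) (mxrange G) (mxnull G).
Proof.
move=> G; have h := @wcEP_outer_inv_TS _ _ _ A W.
rewrite hk mulmxA -/G in h.
by split; last exact: outer_inv_TS_eq.
Qed.
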